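(* Let $\alpha\in(1,2)$ and $\ell>0$, and let $\theta_0$, $V$, $C$, $f^*$, $g^*$ be as defined in the context. Fix $\epsilon\in(0,1)$ and set $$ m_\epsilon^* = (\ell\epsilon)^{-(\alpha-1)} \frac{\alpha}{|\cos(\pi\alpha/2)|} \quad\mbox{and}\quad m_\epsilon^\sharp = \max\{m_\epsilon^*,1\}. $$ 1. For $x\le m^\sharp_\epsilon$ and $-\frac{\pi}{2}<\theta\le \frac{\pi}{2}$, we have $$ g^*(x,\theta) \le C_{1} f^*(x,\theta),\qquad\mbox{where}\quad C_{1} = C e^{m_\epsilon^\sharp/\ell}. $$ 2. For $x\ge m_\epsilon^\sharp$ and $-\theta_0<\theta\le \frac{\pi}{2}$, we have $$ g^*(x,\theta) \le C_{2}\, \frac{\alpha}{\pi}\, e^{-\xi_\epsilon(\theta)(x-m_\epsilon(\theta))^2/2}\sqrt{\frac{2\xi_\epsilon(\theta)}{\pi}} , $$ where $$ m_\epsilon(\theta) = \left(\frac{\alpha-1}{\ell \epsilon V(\theta)\alpha}\right)^{\alpha-1}, \qquad \xi_\epsilon(\theta) = (V(\theta))^{\alpha-1} \frac{(\epsilon\alpha)^{\alpha-1}}{(\alpha-1)^\alpha}\ell^{-(2-\alpha)}, $$ and $$ C_{2} = C^{1-\epsilon^{1-\alpha}} \sqrt{\pi}\, \frac{(\epsilon\alpha)^{(1-\alpha)/2}}{(\alpha-1)^{1-\alpha/2}} \left(\frac{3-\alpha}{e(1-\epsilon)}\right)^{\frac{3-\alpha}{2}} \ell^{1-\alpha/2}\,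 2^{-(4-\alpha)/2}. $$
   Context: Fix $\alpha\in(1,2)$ and $\ell>0$. Define $$ \theta_0 = \frac{\pi}{\alpha}-\frac{\pi}{2}\in\left(0,\frac{\pi}{2}\right),\qquad C = \exp\left(\frac{1}{\ell^{\alpha}\cos(\pi\alpha/2)}\right) $$ (note $\cos(\pi\alpha/2)<0$, so $C<1$), and for $\theta\in[-\pi/2,\pi/2]$ $$ V(\theta) = \left(\cos(\alpha\theta_0)\right)^{1/(\alpha-1)} \left(\cos\theta\right)^{1/(\alpha-1)} \cos\big((\alpha-1)\theta+\alpha\theta_0\big)\left|\sin(\alpha(\theta+\theta_0))\right|^{-\alpha/(\alpha-1)}, $$ where the value at $\theta=\pi/2$ is understood as the limit $$ V(\pi/2) = (\alpha-1)\left(\alpha^{-\alpha}|\cos(\pi\alpha/2)|\right)^{1/(\alpha-1)}, $$ and $V(-\theta_0)=\infty$. Define $$ f^*(x,\theta) = \frac{1}{\pi}\frac{\alpha}{\alpha-1} |x|^{1/(\alpha-1)}\, V(\theta)\, e^{-|x|^{\alpha/(\alpha-1)}V(\theta)} $$ if either ($x>0$ and $-\theta_0<\theta<\pi/2$) or ($x<0$ and $-\pi/2<\theta<-\theta_0$), and $f^*(x,\theta)=0$ otherwise. Define $$ g^*(x,\theta) = C e^{x/\ell} f^*(x,\theta),\qquad x\in\mathbb R. $$ *)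

(* Defs.v *)
From HB Require Import structures.
From mathcomp Require Import all_boot all_order all_algebra.
From mathcomp Require Import all_classical all_reals all_analysis.

Set Implicit Arguments.
Unset Strict Implicit.
Unset Printing Implicit Defensive.

Import Order.TTheory GRing.Theory Num.Theory.

Local Open Scope ring_scope.

Definition theta0 (R : realType) (alpha : R) : R := pi / alpha - pi / 2.

Definition Cst (R : realType) (alpha l : R) : R :=
  expR (1 / (l `^ alpha * cos (pi * alpha / 2))).

(* Only meaningful for theta in [-pi/2, pi/2].  The closed formula is of the
   form 0/0 at pi/2, where its left limit is taken instead, and it has a pole
   at -theta0.  At -pi/2, powR gives 0 `^ (alpha - 1)^-1 = 0 as intended. *)
Definition V (R : realType) (alpha theta : R) : \bar R :=
  if theta == - theta0 alpha then +oo%E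
  else if theta == pi / 2 then
    ((alpha - 1) *
     (alpha `^ (- alpha) * `|cos (pi * alpha / 2)|) `^ (1 / (alpha - 1)))%:E
  else
    (cos (alpha * theta0 alpha) `^ (1 / (alpha - 1)) *
     cos theta `^ (1 / (alpha - 1)) *
     cos ((alpha - 1) * theta + alpha * theta0 alpha) *
     `|sin (alpha * (theta + theta0 alpha))| `^ (- alpha / (alpha - 1)))%:E.

(* The real value of V; [fine] loses information only at theta = - theta0,
   a point excluded everywhere Vr is used. *)
Definition Vr (R : realType) (alpha theta : R) : R := fine (V alpha theta).

Definition f_star (R : realType) (alpha x theta : R) : R :=
  if ((0 < x) && (- theta0 alpha < theta < pi / 2))
     || ((x < 0) && (- (pi / 2) < theta < - theta0 alpha))
  then pi^-1 * (alpha / (alpha - 1)) * `|x| `^ (1 / (alpha - 1)) *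
       Vr alpha theta *
       expR (- (`|x| `^ (alpha / (alpha - 1)) * Vr alpha theta))
  else 0.

Definition g_star (R : realType) (alpha l x theta : R) : R :=
  Cst alpha l * expR (x / l) * f_star alpha x theta.

Definition m_star (R : realType) (alpha l eps : R) : R :=
  (l * eps) `^ (- (alpha - 1)) * (alpha / `|cos (pi * alpha / 2)|).

Definition m_sharp (R : realType) (alpha l eps : R) : R :=
  Num.max (m_star alpha l eps) 1.

Definition C1 (R : realType) (alpha l eps : R) : R :=
  Cst alpha l * expR (m_sharp alpha l eps / l).

Definition m_eps (R : realType) (alpha l eps theta : R) : R :=
  ((alpha - 1) / (l * eps * Vr alpha theta * alpha)) `^ (alpha - 1).

Definition xi_eps (R : realType) (alpha l eps theta : R) : R :=
  Vr alpha theta `^ (alpha - 1) *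
  ((eps * alpha) `^ (alpha - 1) / (alpha - 1) `^ alpha) *
  l `^ (- (2 - alpha)).

Definition C2 (R : realType) (alpha l eps : R) : R :=
  Cst alpha l `^ (1 - eps `^ (1 - alpha)) *
  Num.sqrt pi *
  ((eps * alpha) `^ ((1 - alpha) / 2) / (alpha - 1) `^ (1 - alpha / 2)) *
  ((3 - alpha) / (expR 1 * (1 - eps))) `^ ((3 - alpha) / 2) *
  l `^ (1 - alpha / 2) *
  2 `^ (- (4 - alpha) / 2).

(* Main.v *)
Require Import Defs.
From mathcomp Require Import all_boot all_order all_algebra.
From mathcomp Require Import all_classical all_reals all_analysis.
From mathcomp Require Import ring lra.
Set Implicit Arguments.
Unset Strict Implicit.
Unset Printing Implicit Defensive.
Import Order.TTheory GRing.Theory Num.Theory.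
Import numFieldNormedType.Exports.
Local Open Scope ring_scope.

(** Below the threshold the bound only uses [f_star >= 0] and the monotonicity
    of [expR (x / l)].

    Above it, put [p = alpha / (alpha - 1) > 2] and split the exponent of
    [g_star] as
    [x / l - x `^ p * V = (x / l - eps * x `^ p * V) - (1 - eps) * x `^ p * V].
    The first part is a concave function of [x] with maximum
    [m_eps / (l alpha)], attained at [m_eps]; as [p > 2], for [x >= m_eps] it is
    at most its second-order Taylor polynomial there, whose curvature is
    [- xi_eps] (lemma [tilted_exponent_le]).  This yields the Gaussian factor.
    For [x >= 1] the second part controls the algebraic prefactor
    [x `^ (1 / (alpha - 1)) * V], leaving exactly the power
    [V `^ ((alpha - 1) / 2)] present in [Num.sqrt xi_eps] (lemma
    [prefactor_le]).

    Two facts are needed uniformly in [theta]: that [x >= m_eps theta], and that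
    the maximum [m_eps / (l alpha)] is at most [m_star / (l alpha)], which the
    constant [Cst] turns into a power of itself (lemma [Cst_expR_le]).  Both
    amount to [m_eps theta <= m_star], that is, to [V theta >= V (pi / 2)]
    (lemma [Vr_pihalf_le]).  With [t = pi / 2 - theta],
    [V `^ (alpha - 1)] is a constant times
    [sin t * sin ((alpha - 1) t) `^ (alpha - 1) / sin (alpha t) `^ alpha], and
    since [sin x / x] decreases on [[0, pi]], both sines in the numerator are
    bounded below by [sin (alpha t)] times the ratio of the arguments, with
    equality in the limit [t -> 0]. *)

(** * Elementary inequalities on the real line *)

Lemma le_of_is_derive_ge0 (R : realType) (f df : R -> R) (a b : R) : a <= b ->
  (forall x, a <= x <= b -> is_derive x 1 f (df x)) ->
  (forall x, a <= x <= b -> 0 <= df x) -> f a <= f b.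
Proof.
move=> ab fdf df_ge0; rewrite -subr_ge0.
have fdf_oo x : x \in `]a, b[ -> is_derive x 1 f (df x).
  by rewrite in_itv /= => /andP[ax xb]; apply: fdf; rewrite !ltW.
have fcont : {within `[a, b], continuous f}%classic.
  apply: derivable_within_continuous => x; rewrite in_itv /= => xab.
  by have [] := fdf x xab.
have [x + ->] := MVT_segment ab fdf_oo fcont.
by rewrite in_itv /= => xab; rewrite mulr_ge0 ?subr_ge0 ?df_ge0.
Qed.

(** Concavity of sin on [[0, pi]], in the form in which it says that
    [sin x / x] decreases there: the derivative [c (cos (c y) - cos y)] of the
    difference is nonnegative because [c y <= y]. *)
Lemma mulr_sin_le (R : realType) (c y : R) : 0 <= c <= 1 -> 0 <= y <= pi ->
  c * sin y <= sin (c * y).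
Proof.
move=> /andP[c0 c1] /andP[y0 ypi].
pose f z := sin (c * z) - c * sin z.
have -> : (c * sin y <= sin (c * y)) = (f 0 <= f y).
  by rewrite /f mulr0 sin0 mulr0 subrr subr_ge0.
apply: (@le_of_is_derive_ge0 R f (fun z => c * (cos (c * z) - cos z))) => // z.
  move=> _; rewrite /f.
  apply: is_derive_eq.
  rewrite /GRing.scale /= ; ring.
move=> /andP[z0 zy]; rewrite mulr_ge0 // subr_ge0.
have zpi := le_trans zy ypi.
have cz : c * z <= z by rewrite ler_piMl.
rewrite leNgt ltr_cos ?in_itv /= ?z0 ?zpi // -?leNgt //.
by rewrite mulr_ge0 // (le_trans cz).
Qed.

(** The difference vanishes at [u = 1] and has derivative
    [q (u `^ (q - 1) - 1)]. *)
Lemma bernoulli_powR (R : realType) (q u : R) : 1 <= q -> 1 <= u ->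
  1 + q * (u - 1) <= u `^ q.
Proof.
move=> q1 u1.
pose f z := z `^ q - (1 + q * (z - 1)).
have -> : (1 + q * (u - 1) <= u `^ q) = (f 1 <= f u).
  by rewrite /f powR1 subrr mulr0 addr0 subrr subr_ge0.
apply: (@le_of_is_derive_ge0 R f (fun z => q * (z `^ (q - 1) - 1))) => // z.
  move=> /andP[z1 _]; rewrite /f.
  have z0 : 0 < z by lra.
  have dpow := is_derive1_powR q z0.
  apply: is_derive_eq.
  rewrite /GRing.scale /= ; ring.
move=> /andP[z1 _]; rewrite mulr_ge0 ?subr_ge0 //; first lra.
by rewrite -[leLHS](powRr0 z) ler_powR // subr_ge0.
Qed.

(** The third derivative of [u `^ p] is nonnegative for [p >= 2], so its
    second-order expansion at 1 is a lower bound to the right of 1.  One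
    differentiation reduces this to Bernoulli's inequality with exponent
    [p - 1]; it is here that [p >= 2] is used. *)
Lemma taylor2_powR (R : realType) (p u : R) : 2 <= p -> 1 <= u ->
  1 + p * (u - 1) + p * (p - 1) / 2 * (u - 1) ^+ 2 <= u `^ p.
Proof.
move=> p2 u1.
pose g z := 1 + p * (z - 1) + p * (p - 1) / 2 * (z - 1) ^+ 2.
pose f z := z `^ p - g z.
have -> : (g u <= u `^ p) = (f 1 <= f u).
  by rewrite /f /g powR1 subrr expr0n /= !mulr0 !addr0 subrr subr_ge0.
apply: (@le_of_is_derive_ge0 R f
  (fun z => p * (z `^ (p - 1) - (1 + (p - 1) * (z - 1))))) => // z.
  move=> /andP[z1 _]; rewrite /f /g.
  have z0 : 0 < z by lra.
  have dpow := is_derive1_powR p z0.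
  apply: is_derive_eq.
  rewrite /GRing.scale /= ; by field.
move=> /andP[z1 _]; rewrite mulr_ge0 ?subr_ge0 //; first lra.
by apply: bernoulli_powR => //; lra.
Qed.

(** The right-hand side is the maximum of the left-hand side over [y],
    attained at [y = s / b]; the bound is the [s]-th power of [1 + z <= expR z]
    at [z = b y / s - 1]. *)
Lemma powR_expRN_le (R : realType) (s b y : R) : 0 < s -> 0 < b -> 0 <= y ->
  y `^ s * expR (- (b * y)) <= (s / (expR 1 * b)) `^ s.
Proof.
move=> s0 b0 y0.
have e0 : 0 < expR 1 :> R by exact: expR_gt0.
have key : y <= s / (expR 1 * b) * expR (b * y / s).
  have := expR_ge1Dx (b * y / s - 1).
  rewrite addrC subrK expRB ler_pdivlMr // => h.
  have yE : y = s / (expR 1 * b) * (b * y / s * expR 1).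
    by field; rewrite !gt_eqF.
  by rewrite [leLHS]yE ler_pM2l // divr_gt0 // mulr_gt0.
have -> : expR (- (b * y)) = expR (b * y / s) `^ (- s).
  by rewrite -expRM; congr expR; field; rewrite gt_eqF.
have sb_ge0 : 0 <= s / (expR 1 * b) by rewrite ltW ?divr_gt0 ?mulr_gt0.
rewrite powRN ler_pdivrMr ?powR_gt0 ?expR_gt0 // -powRM ?expR_ge0 //.
by rewrite ge0_ler_powR ?nnegrE ?(ltW s0) // mulr_ge0 ?expR_ge0.
Qed.

(** * The function V *)

Lemma alpha_theta0 (R : realType) (alpha : R) : 0 < alpha ->
  alpha * theta0 alpha = pi - pi * alpha / 2.
Proof. by move=> a0; rewrite /theta0; field; rewrite gt_eqF. Qed.

Lemma cos_pi_alpha2_lt0 (R : realType) (alpha : R) : 1 < alpha < 2 ->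
  cos (pi * alpha / 2) < 0.
Proof.
move=> /andP[a1 a2]; have pi0 := pi_gt0 R.
have -> : pi * alpha / 2 = (pi * alpha / 2 - pi / 2) + pi / 2 by ring.
rewrite cosDpihalf oppr_lt0 sin_gt0_pi //; apply/andP; split; nra.
Qed.

Lemma cos_alpha_theta0 (R : realType) (alpha : R) : 1 < alpha < 2 ->
  cos (alpha * theta0 alpha) = `|cos (pi * alpha / 2)|.
Proof.
move=> halpha; have /andP[a1 _] := halpha.
rewrite alpha_theta0; last lra.
by rewrite cosB cospi sinpi ltr0_norm ?cos_pi_alpha2_lt0 //; ring.
Qed.

(** The only factor of [V] whose sign is not plain is
    [cos ((alpha - 1) theta + alpha theta0)]; its argument increases from
    [(3/2 - alpha) pi] to [pi / 2] as [theta] runs from [- pi / 2] to [pi / 2].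
    At the pole [- theta0] the real value of [V] is 0 by convention. *)
Lemma Vr_ge0 (R : realType) (alpha theta : R) : 1 < alpha < 2 ->
  - (pi / 2) < theta < pi / 2 -> 0 <= Vr alpha theta.
Proof.
move=> /andP[a1 a2] /andP[t1 t2]; have pi0 := pi_gt0 R.
rewrite /Vr /V; case: ifP => // _; rewrite (lt_eqF t2) /=.
rewrite mulr_ge0 ?powR_ge0 // mulr_ge0 //; first by rewrite mulr_ge0 ?powR_ge0.
rewrite alpha_theta0; last lra.
apply: cos_ge0_pihalf; apply/andP; split; nra.
Qed.

(** Both regions where [f_star] is given by its formula lie in
    [- pi / 2 < theta < pi / 2], because [0 < theta0 < pi / 2]. *)
Lemma f_star_ge0 (R : realType) (alpha x theta : R) : 1 < alpha < 2 ->
  0 <= f_star alpha x theta.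
Proof.
move=> halpha; have /andP[a1 a2] := halpha; have pi0 := pi_gt0 R.
rewrite /f_star; case: ifP => // hx.
have V0 : 0 <= Vr alpha theta.
  apply: Vr_ge0 => //.
  have : - (pi / 2) < - theta0 alpha < pi / 2.
    rewrite /theta0; apply/andP; split.
      rewrite ltrN2 ltrBlDr -splitr ltr_pdivrMr; nra.
    rewrite opprB ltrBlDr ltrDl divr_gt0 //; lra.
  case/orP: hx => /andP[_ /andP[h1 h2]] /andP[h3 h4]; apply/andP; split; lra.
rewrite !mulr_ge0 ?powR_ge0 ?expR_ge0 ?invr_ge0 //; lra.
Qed.

Lemma pihalfB_bounds (R : realType) (alpha theta : R) : 0 < alpha ->
  - theta0 alpha < theta < pi / 2 ->
  0 < pi / 2 - theta /\ alpha * (pi / 2 - theta) < pi.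
Proof.
move=> a0 /andP[t1 t2]; split; first by rewrite subr_gt0.
by rewrite mulrC -ltr_pdivlMr //; move: t1; rewrite /theta0; lra.
Qed.

(** Measuring the angle from [pi / 2] by [t = pi / 2 - theta] turns all the
    trigonometric factors of [V] into sines of multiples of [t], and the
    interval [- theta0 < theta < pi / 2] into [0 < alpha t < pi]. *)
Lemma Vr_sin (R : realType) (alpha theta : R) : 1 < alpha < 2 ->
  - theta0 alpha < theta < pi / 2 ->
  let t := pi / 2 - theta in
  Vr alpha theta = `|cos (pi * alpha / 2)| `^ (1 / (alpha - 1)) *
    sin t `^ (1 / (alpha - 1)) * sin ((alpha - 1) * t) *
    sin (alpha * t) `^ (- alpha / (alpha - 1)).
Proof.
move=> halpha /andP[t1 t2] t; have /andP[a1 a2] := halpha.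
have a0 : 0 < alpha by lra.
have pi0 := pi_gt0 R.
rewrite /Vr /V (gt_eqF t1) (lt_eqF t2) /= cos_alpha_theta0 //.
have -> : cos theta = sin t by
  rewrite -cosBpihalf -cosN; congr cos; rewrite /t; ring.
have -> : cos ((alpha - 1) * theta + alpha * theta0 alpha) =
    sin ((alpha - 1) * t).
  rewrite -cosBpihalf -cosN; congr cos; rewrite /t alpha_theta0 //; by field.
have -> : alpha * (theta + theta0 alpha) = pi - alpha * t.
  by rewrite mulrDr alpha_theta0 // /t; field.
have [t0 atpi] : 0 < t /\ alpha * t < pi.
  by apply: pihalfB_bounds => //; rewrite t1.
have sin_ge0 : 0 <= sin (alpha * t).
  by rewrite sin_ge0_pi // mulr_ge0 ?ltW.
by rewrite sinB sinpi cospi mul0r sub0r mulN1r opprK (ger0_norm sin_ge0).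
Qed.

Lemma Vr_pihalf (R : realType) (alpha : R) : 1 < alpha < 2 ->
  Vr alpha (pi / 2) =
  (alpha - 1) *
  (alpha `^ (- alpha) * `|cos (pi * alpha / 2)|) `^ (1 / (alpha - 1)).
Proof.
move=> /andP[a1 a2]; have pi0 := pi_gt0 R.
rewrite /Vr /V eqxx gt_eqF // /theta0 opprB ltrBlDr ltrDl divr_gt0 //; lra.
Qed.

Lemma Vr_pihalf_gt0 (R : realType) (alpha : R) : 1 < alpha < 2 ->
  0 < Vr alpha (pi / 2).
Proof.
move=> halpha; have /andP[a1 a2] := halpha.
rewrite Vr_pihalf // mulr_gt0 ?powR_gt0 //; first lra.
by rewrite mulr_gt0 ?powR_gt0 ?normr_gt0 ?lt_eqF ?cos_pi_alpha2_lt0 //; lra.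
Qed.

(** On [- theta0 < theta <= pi / 2] the minimum of [V] is its limit value at
    [pi / 2].  With [S = sin (alpha t)], concavity of sin gives
    [sin t >= S / alpha] and
    [sin ((alpha - 1) t) >= (alpha - 1) S / alpha]; inserting these two bounds
    in the sine form of [V] makes all powers of [S] cancel and leaves
    [V (pi / 2)]. *)
Lemma Vr_pihalf_le (R : realType) (alpha theta : R) : 1 < alpha < 2 ->
  - theta0 alpha < theta < pi / 2 -> Vr alpha (pi / 2) <= Vr alpha theta.
Proof.
move=> halpha htheta; have /andP[a1 a2] := halpha.
have a0 : 0 < alpha by lra.
rewrite Vr_pihalf // Vr_sin //; set t := pi / 2 - theta.
have [t0 atpi] : 0 < t /\ alpha * t < pi by exact: pihalfB_bounds.
have at0 := mulr_gt0 a0 t0.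
set S := sin (alpha * t).
have S0 : 0 < S by rewrite sin_gt0_pi ?at0.
have le1 : alpha^-1 * S <= sin t.
  have -> : sin t = sin (alpha^-1 * (alpha * t)) by rewrite mulKf ?gt_eqF.
  by apply: mulr_sin_le; rewrite ?invr_ge0 ?invf_le1 ?ltW.
have le2 : (alpha - 1) / alpha * S <= sin ((alpha - 1) * t).
  have -> : (alpha - 1) * t = (alpha - 1) / alpha * (alpha * t).
    by field; rewrite gt_eqF.
  apply: mulr_sin_le; last by rewrite !ltW.
  rewrite ler_pdivrMr // mul1r divr_ge0 /=; lra.
set K := `|cos _|.
have K0 : 0 < K by rewrite normr_gt0 lt_eqF ?cos_pi_alpha2_lt0.
have q0 : 0 < 1 / (alpha - 1) by rewrite divr_gt0 //; lra.
apply: (@le_trans _ _ (K `^ (1 / (alpha - 1)) *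
    (alpha^-1 * S) `^ (1 / (alpha - 1)) * ((alpha - 1) / alpha * S) *
    S `^ (- alpha / (alpha - 1)))).
  (* The two sides are equal: 1/(alpha-1) + 1 - alpha/(alpha-1) = 0 is the
     exponent of S.  Logarithms turn the identity into a linear one. *)
  have b0 : 0 < alpha - 1 by lra.
  rewrite le_eqVlt; apply/orP; left; apply/eqP; apply: ln_inj.
  - by rewrite posrE !(mulr_gt0, powR_gt0, invr_gt0).
  - by rewrite posrE !(mulr_gt0, powR_gt0, invr_gt0).
  rewrite !(lnM, lnV, ln_powR) ?posrE ?(mulr_gt0, powR_gt0, invr_gt0) //.
  by field; rewrite gt_eqF.
have iS0 : 0 <= alpha^-1 * S by rewrite mulr_ge0 ?invr_ge0 ?ltW.
rewrite ler_wpM2r ?powR_ge0 // ler_pM //.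
- by rewrite mulr_ge0 ?powR_ge0.
- by rewrite mulr_ge0 ?divr_ge0 ?ltW // subr_gt0.
- rewrite ler_wpM2l ?powR_ge0 //.
  by rewrite ge0_ler_powR ?nnegrE ?(ltW q0) // (le_trans iS0).
Qed.

(** * The pieces of the Gaussian bound *)

(** This is where the threshold [m_star] comes from: it is the vertex of the
    Gaussian at the angle for which [V] is smallest. *)
Lemma m_eps_pihalf (R : realType) (alpha l eps : R) :
  1 < alpha < 2 -> 0 < l -> 0 < eps ->
  m_eps alpha l eps (pi / 2) = m_star alpha l eps.
Proof.
move=> halpha l0 e0; have /andP[a1 a2] := halpha.
have a0 : 0 < alpha by lra.
have b0 : 0 < alpha - 1 by lra.
rewrite /m_eps /m_star Vr_pihalf //; set K := `|cos _|.
have K0 : 0 < K by rewrite normr_gt0 lt_eqF ?cos_pi_alpha2_lt0.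
apply: ln_inj.
- by rewrite posrE !(mulr_gt0, powR_gt0, invr_gt0).
- by rewrite posrE !(mulr_gt0, powR_gt0, invr_gt0).
rewrite !(ln1, lnM, lnV, ln_powR) ?posrE ?(mulr_gt0, powR_gt0, invr_gt0) //.
by field; rewrite gt_eqF.
Qed.

(** [m_eps] is a decreasing function of [V], so it is largest at
    [theta = pi / 2]. *)
Lemma m_eps_le (R : realType) (alpha l eps theta : R) :
  1 < alpha < 2 -> 0 < l -> 0 < eps -> - theta0 alpha < theta < pi / 2 ->
  m_eps alpha l eps theta <= m_star alpha l eps.
Proof.
move=> halpha l0 e0 htheta; have /andP[a1 a2] := halpha.
have a0 : 0 < alpha by lra.
have b0 : 0 < alpha - 1 by lra.
have V0 := Vr_pihalf_gt0 halpha.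
have leV := Vr_pihalf_le halpha htheta.
have V1 := lt_le_trans V0 leV.
rewrite -(m_eps_pihalf halpha l0 e0) /m_eps.
move: (Vr _ theta) (Vr _ (pi / 2)) V0 V1 leV => v w w0 v0 wv.
apply: ge0_ler_powR; rewrite ?nnegrE.
- exact: ltW.
- by rewrite ltW // !(mulr_gt0, invr_gt0).
- by rewrite ltW // !(mulr_gt0, invr_gt0).
rewrite ler_pM2l // lef_pV2 ?posrE ?mulr_gt0 //.
by rewrite ler_pM2r // ler_pM2l ?mulr_gt0.
Qed.

(** [xi_eps] is minus the second derivative of
    [x / l - eps * x `^ p * V], [p = alpha / (alpha - 1)], at its critical
    point [m_eps]. *)
Lemma xi_epsE (R : realType) (alpha l eps theta : R) :
  1 < alpha -> 0 < l -> 0 < eps -> 0 < Vr alpha theta ->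
  xi_eps alpha l eps theta = ((alpha - 1) * l * m_eps alpha l eps theta)^-1.
Proof.
move=> a1 l0 e0 V0.
have a0 : 0 < alpha by lra.
have b0 : 0 < alpha - 1 by lra.
rewrite /xi_eps /m_eps; apply: ln_inj.
- by rewrite posrE !(mulr_gt0, powR_gt0, invr_gt0).
- by rewrite posrE !(mulr_gt0, powR_gt0, invr_gt0).
rewrite !(ln1, lnM, lnV, ln_powR) ?posrE ?(mulr_gt0, powR_gt0, invr_gt0) //.
by ring.
Qed.

(** The function [h x = x / l - eps * x `^ p * V], [p = alpha / (alpha - 1)],
    has its maximum [m / (l alpha)] at [m = m_eps].  Since [p > 2], its third
    derivative is negative, hence to the right of [m] it lies below its
    second-order expansion at [m].  The bound fails to the left of [m], which
    is why [x] has to exceed all the [m_eps theta]. *)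
Lemma tilted_exponent_le (R : realType) (alpha l eps theta x : R) :
  1 < alpha < 2 -> 0 < l -> 0 < eps -> 0 < Vr alpha theta ->
  m_eps alpha l eps theta <= x ->
  x / l - eps * (x `^ (alpha / (alpha - 1)) * Vr alpha theta) <=
  m_eps alpha l eps theta / (l * alpha) -
    xi_eps alpha l eps theta * (x - m_eps alpha l eps theta) ^+ 2 / 2.
Proof.
move=> /andP[a1 a2] l0 e0 V0 mx; rewrite xi_epsE //.
have a0 : 0 < alpha by lra.
have b0 : 0 < alpha - 1 by lra.
set m := m_eps _ _ _ _ in mx *; set v := Vr _ _ in V0 *.
set p := alpha / (alpha - 1).
have m0 : 0 < m by rewrite powR_gt0 // !(mulr_gt0, invr_gt0).
(* The equation h' m = 0, multiplied by m / p. *)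
have mE : eps * (m `^ p * v) = m / (l * p).
  apply: ln_inj.
  - by rewrite posrE !(mulr_gt0, powR_gt0, invr_gt0).
  - by rewrite posrE !(mulr_gt0, powR_gt0, invr_gt0).
  rewrite /m /m_eps -/v /p.
  rewrite !(ln1, lnM, lnV, ln_powR) ?posrE ?(mulr_gt0, powR_gt0, invr_gt0) //.
  by field; rewrite gt_eqF.
have p2 : 2 <= p by rewrite ler_pdivlMr //; lra.
have u1 : 1 <= x / m by rewrite ler_pdivlMr // mul1r.
have := taylor2_powR p2 u1.
set u := x / m in u1 * => hu.
have xE : x = m * u by rewrite /u mulrC divfK ?gt_eqF.
have u0 : 0 <= u by lra.
have c0 : 0 <= m / (l * p) by rewrite !(mulr_ge0, invr_ge0) ?ltW //; lra.
have := ler_wpM2l c0 hu; move=> {}hu.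
have -> : eps * (x `^ p * v) = m / (l * p) * u `^ p.
  by rewrite -mE xE powRM ?(ltW m0) //; ring.
apply: (le_trans (lerB (lexx _) hu)).
rewrite le_eqVlt; apply/orP; left; apply/eqP.
by rewrite xE /p; field; rewrite !gt_eqF.
Qed.

(** For [m = m_star] this is an equality, since
    [m_star / (l alpha) = - eps `^ (1 - alpha) * ln (Cst alpha l)]. *)
Lemma Cst_expR_le (R : realType) (alpha l eps m : R) :
  1 < alpha < 2 -> 0 < l -> 0 < eps -> m <= m_star alpha l eps ->
  Cst alpha l * expR (m / (l * alpha)) <=
  Cst alpha l `^ (1 - eps `^ (1 - alpha)).
Proof.
move=> halpha l0 e0 mle; have /andP[a1 a2] := halpha.
have a0 : 0 < alpha by lra.
have c0 := cos_pi_alpha2_lt0 halpha.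
rewrite /Cst -expRM -expRD ler_expR.
set c := cos _ in c0 *.
have -> : 1 / (l `^ alpha * c) * (1 - eps `^ (1 - alpha)) =
  1 / (l `^ alpha * c) + m_star alpha l eps / (l * alpha).
  rewrite /m_star -/c ltr0_norm // powRM ?ltW // opprB.
  have -> : l `^ alpha = l * l `^ (alpha - 1).
    by rewrite mulr_powRB1 // ltW.
  have -> : l `^ (1 - alpha) = (l `^ (alpha - 1))^-1 by rewrite -powRN opprB.
  have : 0 < l `^ (alpha - 1) by rewrite powR_gt0.
  by move=> P; field; rewrite (lt_eqF c0) !gt_eqF.
by rewrite lerD2l ler_pM2r // invr_gt0 mulr_gt0.
Qed.

(** With [s = (3 - alpha) / 2] and [p = alpha / (alpha - 1)] one has
    [1 / (alpha - 1) <= p s], an inequality equivalent to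
    [(alpha - 1) (2 - alpha) >= 0].  For [x >= 1] this gives
    [x `^ (1 / (alpha - 1)) * V <= V `^ (1 - s) * (x `^ p * V) `^ s], and the
    last power is absorbed by the remaining exponential.  The exponent
    [1 - s = (alpha - 1) / 2] is the one with which [V] enters the square root
    of [xi_eps]. *)
Lemma prefactor_le (R : realType) (alpha b x v : R) :
  1 < alpha < 2 -> 0 < b -> 1 <= x -> 0 < v ->
  x `^ (1 / (alpha - 1)) * v *
  expR (- (b * (x `^ (alpha / (alpha - 1)) * v))) <=
  v `^ ((alpha - 1) / 2) *
  ((3 - alpha) / 2 / (expR 1 * b)) `^ ((3 - alpha) / 2).
Proof.
move=> /andP[a1 a2] b0 x1 v0.
have a0 : 0 < alpha by lra.
have c0 : 0 < alpha - 1 by lra.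
have x0 : 0 < x by lra.
set s := (3 - alpha) / 2; set p := alpha / (alpha - 1).
have s0 : 0 < s by rewrite divr_gt0 //; lra.
have y0 : 0 <= x `^ p * v by rewrite mulr_ge0 ?powR_ge0 ?ltW.
have := powR_expRN_le s0 b0 y0.
rewrite powRM ?powR_ge0 ?(ltW v0) // -powRrM => hy.
apply: le_trans (ler_wpM2l (powR_ge0 _ _) hy).
rewrite [leRHS]mulrA ler_wpM2r ?expR_ge0 //.
have -> : v `^ ((alpha - 1) / 2) * (x `^ (p * s) * v `^ s) = x `^ (p * s) * v.
  rewrite mulrCA -powRD; last by rewrite (gt_eqF v0) implybT.
  have -> : (alpha - 1) / 2 + s = 1 by rewrite /s; field.
  by rewrite powRr1 ?ltW.
rewrite ler_wpM2r ?(ltW v0) // ler_powR // /p /s.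
rewrite mulrAC ler_pM2r ?invr_gt0 // mulrA ler_pdivlMr //; nra.
Qed.

(** The powers of [eps alpha], [l] and [pi] in [C2] cancel those coming from
    [xi_eps], so that only the constants of [Cst_expR_le] and [prefactor_le] and
    the factor [1 / (alpha - 1)] of [f_star] remain. *)
Lemma C2_sqrtE (R : realType) (alpha l eps theta : R) :
  1 < alpha < 2 -> 0 < l -> 0 < eps < 1 -> 0 < Vr alpha theta ->
  C2 alpha l eps * Num.sqrt (2 * xi_eps alpha l eps theta / pi) =
  Cst alpha l `^ (1 - eps `^ (1 - alpha)) / (alpha - 1) *
  (Vr alpha theta `^ ((alpha - 1) / 2) *
    ((3 - alpha) / 2 / (expR 1 * (1 - eps))) `^ ((3 - alpha) / 2)).
Proof.
move=> /andP[a1 a2] l0 /andP[e0 e1] V0; have pi0 := pi_gt0 R.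
have a0 : 0 < alpha by lra.
have b0 : 0 < alpha - 1 by lra.
have c0 : 0 < 3 - alpha by lra.
have d0 : 0 < 1 - eps by lra.
have C0 : 0 < Cst alpha l by exact: expR_gt0.
have x0 : 0 < xi_eps alpha l eps theta.
  by rewrite !(mulr_gt0, powR_gt0, invr_gt0).
have i0 : 0 < expR 1 :> R by exact: expR_gt0.
rewrite /C2 -!powR12_sqrt ?ltW ?(mulr_gt0, powR_gt0, invr_gt0) //.
set k := 1 - eps `^ (1 - alpha).
rewrite /xi_eps; apply: ln_inj.
- by rewrite posrE !(mulr_gt0, powR_gt0, invr_gt0).
- by rewrite posrE !(mulr_gt0, powR_gt0, invr_gt0).
rewrite !(ln1, lnM, lnV, ln_powR) ?posrE ?(mulr_gt0, powR_gt0, invr_gt0) //.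
by field.
Qed.

(** * The bounds for the tilted density *)

Theorem theorem1 (R : realType) (alpha l eps : R)
    (halpha : 1 < alpha < 2) (hl : 0 < l) (heps : 0 < eps < 1) :
  (forall x theta : R,
      x <= m_sharp alpha l eps -> - (pi / 2) < theta <= pi / 2 ->
      g_star alpha l x theta <= C1 alpha l eps * f_star alpha x theta)
  /\
  (forall x theta : R,
      m_sharp alpha l eps <= x -> - theta0 alpha < theta <= pi / 2 ->
      g_star alpha l x theta <=
        C2 alpha l eps * (alpha / pi) *
        expR (- (xi_eps alpha l eps theta *
                 (x - m_eps alpha l eps theta) ^+ 2 / 2)) *
        Num.sqrt (2 * xi_eps alpha l eps theta / pi)).
Proof.
have C0 : 0 < Cst alpha l by exact: expR_gt0.
split=> x theta hx htheta.
  rewrite /g_star /C1 ler_wpM2r ?f_star_ge0 // ler_pM2l // ler_expR.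
  by rewrite ler_pM2r // invr_gt0.
have [a1 a2] := andP halpha; have [e0 e1] := andP heps.
have pi0 := pi_gt0 R; have [t1 t2] := andP htheta.
have x1 : 1 <= x by apply: le_trans hx; rewrite /m_sharp le_max lexx orbT.
have mx : m_star alpha l eps <= x.
  by apply: le_trans hx; rewrite /m_sharp le_max lexx.
rewrite /g_star /f_star.
have x0 : 0 < x by lra.
(* At theta = pi / 2 the density f_star is 0 by definition. *)
move: t2; rewrite le_eqVlt => /orP[/eqP tE|t2].
  rewrite tE ltxx !andbF (ltNge x 0) (ltW x0) /= mulr0.
  have C2_ge0 : 0 <= C2 alpha l eps.
    by rewrite !mulr_ge0 ?invr_ge0 ?powR_ge0 ?sqrtr_ge0.
  rewrite mulr_ge0 ?sqrtr_ge0 // mulr_ge0 ?expR_ge0 // mulr_ge0 //.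
  rewrite divr_ge0; lra.
have htheta' : - theta0 alpha < theta < pi / 2 by rewrite t1.
rewrite x0 htheta' /= ger0_norm ?(ltW x0) //.
have V0 : 0 < Vr alpha theta.
  exact: lt_le_trans (Vr_pihalf_gt0 halpha) (Vr_pihalf_le halpha htheta').
have mle := m_eps_le halpha hl e0 htheta'.
have hexp := tilted_exponent_le halpha hl e0 V0 (le_trans mle mx).
have hC := Cst_expR_le halpha hl e0 mle.
have d0 : 0 < 1 - eps by lra.
have b0 : 0 < alpha - 1 by lra.
have hpre := prefactor_le halpha d0 x1 V0.
have hC2 := C2_sqrtE halpha hl heps V0.
move: hexp hpre hC2.
set v := Vr alpha theta; set Y := x `^ (alpha / (alpha - 1)) * v.
set X := x `^ (1 / (alpha - 1)); set M := m_eps _ _ _ _ in hC *.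
set G := xi_eps _ _ _ _ * _ / 2.
set P := v `^ _ * _ `^ ((3 - alpha) / 2).
move=> hexp hpre hC2.
have -> : C2 alpha l eps * (alpha / pi) * expR (- G) *
    Num.sqrt (2 * xi_eps alpha l eps theta / pi) =
    alpha / pi / (alpha - 1) *
    (Cst alpha l `^ (1 - eps `^ (1 - alpha)) * expR (- G) * P).
  rewrite mulrAC [X in X * _]mulrAC hC2.
  by rewrite /P; move: (pi^-1) => ipi; field; rewrite gt_eqF.
(* The exponent is split into its eps part, which gives the Gaussian, and the
   remaining 1 - eps part, which absorbs the prefactor. *)
have -> : Cst alpha l * expR (x / l) *
    (pi^-1 * (alpha / (alpha - 1)) * X * v * expR (- Y)) =
    alpha / pi / (alpha - 1) *
    (Cst alpha l * expR (x / l - eps * Y) *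
      (X * v * expR (- ((1 - eps) * Y)))).
  have eE : expR (x / l) * expR (- Y) =
      expR (x / l - eps * Y) * expR (- ((1 - eps) * Y)).
    by rewrite -!expRD; congr expR; ring.
  transitivity (alpha / pi / (alpha - 1) *
    (Cst alpha l * (expR (x / l) * expR (- Y)) * (X * v))).
    by move: (pi^-1) => ipi; field; rewrite gt_eqF.
  by rewrite eE; ring.
rewrite ler_pM2l; last by rewrite !(mulr_gt0, invr_gt0) //; lra.
apply: ler_pM => //.
- by rewrite mulr_ge0 ?expR_ge0 // ltW.
- by rewrite !mulr_ge0 ?powR_ge0 ?expR_ge0 // ltW.
have hexp' : expR (x / l - eps * Y) <= expR (M / (l * alpha)) * expR (- G).
  by rewrite -expRD ler_expR.
apply: (le_trans (ler_wpM2l (ltW C0) hexp')).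
by rewrite mulrA ler_wpM2r ?expR_ge0.
Qed.
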